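(* Strong duality holds for the V-Lagrangian dual of the two-block problem, that is, $\mathrm{OPT}=\mathrm{DUAL}^V$.
   Context: Two-block problem. For $i\in\{1,2\}$ let $$\mathcal{X}^{(i)}=\{(x^{(i)},y^{(i)}): A^{(i)}x^{(i)}+B^{(i)}y^{(i)}\le b^{(i)},\ y^{(i)}\ge 0 \text{ mixed-integer},\ x^{(i)}\in\{0,1\}^n\},$$ where ''mixed-integer'' means that a prescribed subset of the coordinates of $y^{(i)}$ is required to be integer, and $A^{(i)},B^{(i)},b^{(i)}$ and the objective vectors $c^{(i)},d^{(i)}$ are rational of suitable dimensions. Let $$\mathrm{OPT}=\min\Big\{\sum_{i\in\{1,2\}}\langle c^{(i)},x^{(i)}\rangle+\langle d^{(i)},y^{(i)}\rangle:\ (x^{(i)},y^{(i)})\in\mathcal{X}^{(i)},\ i\in\{1,2\},\ x^{(1)}=x^{(2)}\Big\},$$ where it is assumed that this minimum exists (the problem has an optimal solution). V-Lagrangian dual. For a vertex $v\in\{0,1\}^n$ of $[0,1]^n$ put $\sigma_{v_j}(u)=u$ if $v_j=1$ and $\sigma_{v_j}(u)=1-u$ if $v_j=0$. Let $$\mathcal{X}^{(i)}_V=\Big\{(x^{(i)},y^{(i)},w^{(i)}):(x^{(i)},y^{(i)})\in\mathcal{X}^{(i)},\ w^{(i)}_v=\prod_{s\in[n]}\sigma_{v_s}(x^{(i)}_s)\ \text{ for every vertex } v \text{ of } [0,1]^n\Big\}.$$ For $\lambda\in\mathbb{R}^n$, $\mu\in\mathbb{R}^{\{0,1\}^n}$ let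 $L^V(\lambda,\mu)$ be the minimum of $$\sum_{i\in\{1,2\}}\big(\langle c^{(i)},x^{(i)}\rangle+\langle d^{(i)},y^{(i)}\rangle\big)+\langle\lambda,x^{(1)}-x^{(2)}\rangle+\langle\mu,w^{(1)}-w^{(2)}\rangle$$ over $(x^{(i)},y^{(i)},w^{(i)})\in\mathcal{X}^{(i)}_V$, $i\in\{1,2\}$, and let $\mathrm{DUAL}^V=\max_{\lambda,\mu}L^V(\lambda,\mu)$ (read as a supremum). *)

(* Defs.v *)
From mathcomp Require Import all_boot all_order all_algebra.
From mathcomp Require Import all_classical all_reals all_analysis.

Set Implicit Arguments.
Unset Strict Implicit.
Unset Printing Implicit Defensive.

Import Order.TTheory GRing.Theory Num.Theory.

Local Open Scope classical_set_scope.
Local Open Scope ring_scope.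

(* The rational data of one block with n linking binary variables:
   A x + B y <= b, y >= 0, and y_j required integer for j in [intv]. *)
Record block (n : nat) := Block {
  nrow : nat;
  ncol : nat;
  Amx : 'M[rat]_(nrow, n);
  Bmx : 'M[rat]_(nrow, ncol);
  bvec : 'cV[rat]_nrow;
  cvec : 'cV[rat]_n;
  dvec : 'cV[rat]_ncol;
  intv : {set 'I_ncol}
}.

(* A vertex of [0,1]^n, with true standing for 1 and false for 0. *)
Definition vertex (n : nat) := {ffun 'I_n -> bool}.

Definition dotp (R : realType) (k : nat) (u v : 'cV[R]_k) : R :=
  \sum_(j < k) u j 0 * v j 0.

Definition feasible (R : realType) (n : nat) (P : block n) :
    set ('cV[R]_n * 'cV[R]_(ncol P)) :=
  [set z | [/\ forall k, (map_mx ratr (Amx P) *m z.1 +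
                          map_mx ratr (Bmx P) *m z.2) k 0 <= ratr (bvec P k 0),
               forall j, 0 <= z.2 j 0,
               forall j, j \in intv P -> z.2 j 0 \is a Num.int
             & forall j, z.1 j 0 = 0 \/ z.1 j 0 = 1]].
Arguments feasible {R n} P.

Definition cost (R : realType) (n : nat) (P : block n)
    (z : 'cV[R]_n * 'cV[R]_(ncol P)) : R :=
  dotp (map_mx ratr (cvec P)) z.1 + dotp (map_mx ratr (dvec P)) z.2.
Arguments cost {R n} P z.

Definition joint_feasible (R : realType) (n : nat) (P1 P2 : block n) :
    set (('cV[R]_n * 'cV[R]_(ncol P1)) * ('cV[R]_n * 'cV[R]_(ncol P2))) :=
  [set z | [/\ feasible P1 z.1, feasible P2 z.2 & z.1.1 = z.2.1]].
Arguments joint_feasible {R n} P1 P2.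

Definition joint_cost (R : realType) (n : nat) (P1 P2 : block n)
    (z : ('cV[R]_n * 'cV[R]_(ncol P1)) * ('cV[R]_n * 'cV[R]_(ncol P2))) : R :=
  cost P1 z.1 + cost P2 z.2.
Arguments joint_cost {R n} P1 P2 z.

Definition optimal (R : realType) (n : nat) (P1 P2 : block n)
    (z : ('cV[R]_n * 'cV[R]_(ncol P1)) * ('cV[R]_n * 'cV[R]_(ncol P2))) : Prop :=
  joint_feasible P1 P2 z /\
  forall z', joint_feasible P1 P2 z' -> joint_cost P1 P2 z <= joint_cost P1 P2 z'.
Arguments optimal {R n} P1 P2 z.

(* The minimum of the joint problem whenever an optimal solution exists. *)
Definition opt (R : realType) (n : nat) (P1 P2 : block n) : \bar R :=
  ereal_inf [set (joint_cost P1 P2 z)%:E | z in @joint_feasible R n P1 P2].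

Definition sigma (R : realType) (a : bool) (u : R) : R :=
  if a then u else 1 - u.

Definition feasibleV (R : realType) (n : nat) (P : block n) :
    set ('cV[R]_n * 'cV[R]_(ncol P) * {ffun vertex n -> R}) :=
  [set z : 'cV[R]_n * 'cV[R]_(ncol P) * {ffun vertex n -> R} |
    feasible P z.1 /\
    forall v : vertex n, z.2 v = \prod_(s < n) sigma (v s) (z.1.1 s 0)].
Arguments feasibleV {R n} P.

Definition lagrangianV (R : realType) (n : nat) (P1 P2 : block n)
    (lam : 'cV[R]_n) (mu : {ffun vertex n -> R})
    (z1 : 'cV[R]_n * 'cV[R]_(ncol P1) * {ffun vertex n -> R})
    (z2 : 'cV[R]_n * 'cV[R]_(ncol P2) * {ffun vertex n -> R}) : R :=
  (cost P1 z1.1 + cost P2 z2.1) + dotp lam (z1.1.1 - z2.1.1)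
  + \sum_(v : vertex n) mu v * (z1.2 v - z2.2 v).
Arguments lagrangianV {R n} P1 P2 lam mu z1 z2.

(* L^V(lam, mu): the minimum is written as an infimum in the extended reals,
   which avoids having to presuppose that it is attained. *)
Definition LV (R : realType) (n : nat) (P1 P2 : block n)
    (lam : 'cV[R]_n) (mu : {ffun vertex n -> R}) : \bar R :=
  ereal_inf [set (lagrangianV P1 P2 lam mu z1 z2)%:E
            | z1 in @feasibleV R n P1 & z2 in @feasibleV R n P2].

Definition dualV (R : realType) (n : nat) (P1 P2 : block n) : \bar R :=
  ereal_sup [set LV P1 P2 lm.1 lm.2
            | lm in [set: 'cV[R]_n * {ffun vertex n -> R}]].

(* Main.v *)
(** On feasible points, [w v] is the indicator of [x = v], so the multiplier
    [mu] shifts the value of each block independently at every vertex. Taking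
    [mu v] to be minus the value of block 1 at [v] makes [L^V(0, mu) >= OPT],
    provided that neither block is unbounded below at any vertex, even one where
    the other block is infeasible. This holds because the recession cone
    [B r <= 0, r >= 0] does not depend on the vertex: a rational ray of negative
    cost, scaled to be integral, would improve the joint optimum, and if there is
    no such ray then Farkas' lemma gives a dual bound valid at all vertices. *)
Require Import Defs.
From mathcomp Require Import all_boot all_order all_algebra.
From mathcomp Require Import all_classical all_reals all_analysis.
From mathcomp Require Import lra.

Set Implicit Arguments.
Unset Strict Implicit.
Unset Printing Implicit Defensive.

Import Order.TTheory GRing.Theory Num.Theory.

Local Open Scope classical_set_scope.
Local Open Scope ring_scope.

(** * Farkas' lemma over an ordered field *)

Lemma mulmx_ge0 (F : numDomainType) (m n p : nat) (A : 'M[F]_(m, n))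
    (B : 'M[F]_(n, p)) :
  (forall i j, 0 <= A i j) -> (forall i j, 0 <= B i j) ->
  forall i j, 0 <= (A *m B) i j.
Proof. by move=> hA hB i j; rewrite mxE sumr_ge0 // => k _; rewrite mulr_ge0. Qed.

(* Bartl's induction: a direction [y] that obeys the last [m] inequalities but
   violates the conclusion violates the first one, and projecting along [y]
   onto the kernel of the first row eliminates that row. *)
Lemma farkas (F : realFieldType) (m k : nat) (A : 'M[F]_(m, k)) (c : 'rV[F]_k) :
  (forall x : 'cV[F]_k, (forall i, (A *m x) i 0 <= 0) -> (c *m x) 0 0 <= 0) ->
  exists2 u : 'rV[F]_m, (forall i, 0 <= u 0 i) & c = u *m A.
Proof.
elim: m A c => [|m IHm] A c hc.
  exists 0; first by case.
  apply/rowP => j; rewrite mul0mx mxE.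
  have hd (a : F) : a * c 0 j <= 0.
    have -> : a * c 0 j = (c *m (a *: delta_mx j 0 : 'cV[F]_k)) 0 0.
      by rewrite -scalemxAr -colE !mxE.
    by apply: hc => -[].
  by have := hd 1; have := hd (- 1); lra.
pose A1 : 'rV[F]_k := usubmx (A : 'M[F]_(1 + m, k)).
pose A2 : 'M[F]_(m, k) := dsubmx (A : 'M[F]_(1 + m, k)).
have AE : A = col_mx A1 A2 :> 'M[F]_(1 + m, k) by rewrite vsubmxK.
have mulE (a : 'rV[F]_1) (u : 'rV[F]_m) :
    (row_mx a u : 'rV[F]_(1 + m)) *m (A : 'M[F]_(1 + m, k)) = a *m A1 + u *m A2.
  by rewrite -mul_row_col vsubmxK.
have hA (x : 'cV[F]_k) : (A1 *m x) 0 0 <= 0 -> (forall i, (A2 *m x) i 0 <= 0) ->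
    (c *m x) 0 0 <= 0.
  move=> h1 h2; apply: hc => i; rewrite AE.
  rewrite (_ : (_ *m x) i 0 = col_mx (A1 *m x) (A2 *m x) i 0); last first.
    by rewrite -mul_col_mx.
  rewrite mxE; case: splitP => j _; last exact: h2.
  by rewrite ord1.
have [[y hy cy]|hno] := pselect
    (exists2 y : 'cV[F]_k, (forall i, (A2 *m y) i 0 <= 0) & 0 < (c *m y) 0 0);
  last first.
  have [|u u0 uE] := IHm A2 c.
    by move=> x hx; rewrite leNgt; apply/negP => cx; apply: hno; exists x.
  exists (row_mx (0 : 'rV[F]_1) u : 'rV[F]_(1 + m)).
    by move=> i; rewrite mxE; case: splitP => j _; rewrite ?mxE.
  by apply: etrans (esym (mulE _ _)); rewrite mul0mx add0r.
have a0 : 0 < (A1 *m y) 0 0.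
  by rewrite ltNge; apply/negP => h; have := hA y h hy; rewrite leNgt cy.
wlog a1 : y hy cy {a0} / A1 *m y = 1%:M.
  move=> W; apply: (W (((A1 *m y) 0 0)^-1 *: y)).
  - by move=> i; rewrite -scalemxAr mxE pmulr_rle0 ?invr_gt0.
  - by rewrite -scalemxAr mxE pmulr_rgt0 ?invr_gt0.
  - by rewrite -scalemxAr [X in _ *: X]mx11_scalar scale_scalar_mx mulVf ?gt_eqF.
have [|u u0 uE] := IHm (A2 - A2 *m y *m A1) (c - c *m y *m A1).
  move=> x hx; rewrite mulmxBl -!mulmxA -mulmxBr; apply: hA.
    by rewrite mulmxBr mulmxA a1 mul1mx subrr mxE.
  by move=> i; have := hx i; rewrite mulmxBl -!mulmxA -mulmxBr.
(* Expanding [c - c *m y *m A1 = u *m (A2 - A2 *m y *m A1)] leaves this coefficient on [A1]. It is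
   nonnegative since [c *m y > 0], [A2 *m y <= 0] and [u >= 0]. *)
exists (row_mx (c *m y - u *m A2 *m y) u : 'rV[F]_(1 + m)).
  move=> i; rewrite mxE; case: splitP => j _ //.
  rewrite (ord1 j) mxE [X in _ + X]mxE subr_ge0 (le_trans _ (ltW cy)) //.
  rewrite -mulmxA mxE.
  by apply: sumr_le0 => l _; rewrite mulr_ge0_le0.
apply: etrans (esym (mulE _ _)); rewrite -[LHS](subrK (c *m y *m A1)) uE.
by rewrite mulmxBr mulmxBl !mulmxA [RHS]addrC -addrA [- _ + _]addrC.
Qed.

(** * Recession rays and lower bounds for a single block *)

Lemma dotpE (R : realType) (k : nat) (u v : 'cV[R]_k) :
  dotp u v = (u^T *m v) 0 0.
Proof. by rewrite mxE; apply: eq_bigr => j _; rewrite mxE. Qed.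

Lemma ray_integral_scaling (k : nat) (r : 'cV[rat]_k) :
  exists2 N : rat, 0 < N & forall j, (N *: r) j 0 \is a Num.int.
Proof.
exists (\prod_j (denq (r j 0))%:~R).
  by apply: prodr_gt0 => j _; rewrite ltr0z denq_gt0.
move=> j; rewrite mxE (bigD1 j) //= mulrAC.
rewrite [X in X * _]mulrC -{1}[r j 0]divq_num_den divfK ?intr_eq0 ?denq_eq0 //.
by rewrite rpredM // ?intr_int //; apply: rpred_prod => i _; apply: intr_int.
Qed.

Section BlockBound.
Variables (R : realType) (n : nat) (P : block n).

Lemma feasible_ray (x : 'cV[R]_n) (y : 'cV[R]_(ncol P)) (r : 'cV[rat]_(ncol P)) :
  feasible P (x, y) -> (forall k, (Bmx P *m r) k 0 <= 0) ->
  (forall j, 0 <= r j 0) -> (forall j, r j 0 \is a Num.int) ->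
  feasible P (x, y + map_mx ratr r).
Proof.
move=> [/= h1 h2 h3 h4] hB r0 rint; split=> //=.
- move=> k; rewrite mulmxDr addrA -map_mxM mxE (le_trans _ (h1 k)) //.
  by rewrite gerDl mxE lerq0.
- by move=> j; rewrite !mxE addr_ge0 // ler0q.
- move=> j jI; rewrite !mxE rpredD ?h3 //.
  by have /intrP[m ->] := rint j; rewrite ratr_int intr_int.
Qed.

(** One step along an integral positive multiple of [r] stays feasible with the same [x], and it
    changes the cost by a positive multiple of the cost of [r]. *)
Lemma no_improving_ray (z0 : 'cV[R]_n * 'cV[R]_(ncol P)) (r : 'cV[rat]_(ncol P)) :
  feasible P z0 ->
  (forall y, feasible P (z0.1, y) -> cost P z0 <= cost P (z0.1, y)) ->
  (forall k, (Bmx P *m r) k 0 <= 0) -> (forall j, 0 <= r j 0) ->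
  0 <= ((dvec P)^T *m r) 0 0.
Proof.
case: z0 => x y /= fz opty hB r0.
have [N N0 Nint] := ray_integral_scaling r.
have /opty : feasible P (x, y + map_mx ratr (N *: r)).
  apply: feasible_ray => // [k|j].
    by rewrite -scalemxAr mxE pmulr_rle0.
  by rewrite mxE mulr_ge0 // ltW.
rewrite /cost /= lerD2l !dotpE mulmxDr [leRHS]mxE lerDl map_trmx -map_mxM mxE ler0q.
by rewrite -scalemxAr mxE pmulr_rge0.
Qed.

Lemma cost_lower_bound (z0 : 'cV[R]_n * 'cV[R]_(ncol P)) :
  feasible P z0 ->
  (forall y, feasible P (z0.1, y) -> cost P z0 <= cost P (z0.1, y)) ->
  exists l : 'cV[R]_n -> R, forall z, feasible P z -> l z.1 <= cost P z.
Proof.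
move=> fz0 optz0.
(* Farkas is applied over [rat] because only rational rays are known to scale to integral ones. The
   rows [- 1%:M] encode [r >= 0], so the certificate reads [d = u2 - u1 B] with [u1, u2 >= 0]. *)
have [|u u0 uE] := @farkas rat _ _ (col_mx (Bmx P) (- 1%:M)) (- (dvec P)^T).
  move=> r hr; rewrite mulNmx mxE oppr_le0.
  apply: (no_improving_ray fz0 optz0) => [k|j].
    by have := hr (lshift _ k); rewrite mul_col_mx col_mxEu.
  by have := hr (rshift _ j); rewrite mul_col_mx col_mxEd mulNmx mul1mx mxE oppr_le0.
pose u1 : 'rV[R]_(nrow P) := map_mx ratr (lsubmx u).
pose u2 : 'rV[R]_(ncol P) := map_mx ratr (rsubmx u).
have dE : (map_mx ratr (dvec P))^T = u2 - u1 *m map_mx ratr (Bmx P).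
  rewrite map_trmx -[X in map_mx _ X]opprK uE -[u in LHS]hsubmxK mul_row_col.
  by rewrite mulmxN mulmx1 opprB map_mxB map_mxM.
exists (fun x => dotp (map_mx ratr (cvec P)) x
  - (u1 *m (map_mx ratr (bvec P) - map_mx ratr (Amx P) *m x)) 0 0).
case=> x y [/= h1 h2 _ _]; rewrite /cost /= lerD2l dotpE dE.
rewrite -subr_ge0 opprK.
(* The gap between cost and bound is [u2] paired with [y] plus [u1] paired with the row slacks,
   whatever [x] is. *)
have -> : ((u2 - u1 *m map_mx ratr (Bmx P)) *m y) 0 0 +
    (u1 *m (map_mx ratr (bvec P) - map_mx ratr (Amx P) *m x)) 0 0 =
  (u2 *m y) 0 0 + (u1 *m (map_mx ratr (bvec P) -
    (map_mx ratr (Amx P) *m x + map_mx ratr (Bmx P) *m y))) 0 0.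
  rewrite opprD addrA [in RHS]mulmxDr mulmxN mulmxBl mulmxA !mxE; lra.
apply: addr_ge0; apply: mulmx_ge0 => i j; rewrite ?ord1.
- by rewrite !mxE ler0q.
- exact: h2.
- by rewrite !mxE ler0q.
- by have := h1 i; rewrite !mxE subr_ge0.
Qed.

End BlockBound.

(** * Vertex indicators and the choice of a multiplier *)

Definition vertex_of (R : realType) (n : nat) (x : 'cV[R]_n) : vertex n :=
  [ffun j => x j 0 == 1].

(** Each factor is the indicator that [v] and [x] agree in one coordinate. *)
Lemma prod_sigmaE (R : realType) (n : nat) (x : 'cV[R]_n) (v : vertex n) :
  (forall j, x j 0 = 0 \/ x j 0 = 1) ->
  \prod_(s < n) sigma (v s) (x s 0) = (v == vertex_of x)%:R.
Proof.
move=> hx.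
have sE s : sigma (v s) (x s 0) = (v s == vertex_of x s)%:R.
  rewrite /sigma ffunE; case: (hx s) => ->; rewrite ?eqxx ?(eq_sym 0) ?oner_eq0;
  by case: (v s); rewrite ?subr0 ?subrr.
under eq_bigr do rewrite sE.
have [->|/eqP vx] := eqVneq v (vertex_of x); first by rewrite big1 // => s _; rewrite eqxx.
have [s hs] : exists s, v s != vertex_of x s.
  apply/existsP; rewrite -[X in is_true X]negbK negb_exists; apply/negP => /forallP h.
  by apply: vx; apply/ffunP => s; apply/eqP; have := h s; rewrite negbK.
by rewrite (bigD1 s) //= (negbTE hs) mul0r.
Qed.

Lemma sum_feasibleV (R : realType) (n : nat) (P : block n)
    (mu : {ffun vertex n -> R}) z :
  feasibleV P z -> \sum_v mu v * z.2 v = mu (vertex_of z.1.1).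
Proof.
case=> -[_ _ _ hx] hw.
rewrite (bigD1 (vertex_of z.1.1)) //= big1 => [|v vx].
  by rewrite hw prod_sigmaE // eqxx mulr1 addr0.
by rewrite hw prod_sigmaE // (negbTE vx) mulr0.
Qed.

(* [l2] is the reference value for [m] when [S1] is empty, where [inf S1] is junk. *)
Lemma separating_multiplier (R : realType) (S1 S2 : set R) (l1 l2 a : R) :
  lbound S1 l1 -> lbound S2 l2 -> (forall s t, S1 s -> S2 t -> a <= s + t) ->
  exists m : R, (forall s, S1 s -> 0 <= s + m) /\ (forall t, S2 t -> a <= t - m).
Proof.
move=> h1 h2 h12; have [[s0 Ss0]|S10] := pselect (S1 !=set0); last first.
  exists (l2 - a); split=> [s Ss|t /h2]; last by lra.
  by exfalso; apply: S10; exists s.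
exists (- inf S1); split=> [s Ss|t St].
  by rewrite subr_ge0; apply: ge_inf => //; exists l1.
rewrite opprK -lerBlDl; apply: lb_le_inf; first by exists s0.
by move=> s Ss; have := h12 _ _ Ss St; lra.
Qed.

(** * Weak and strong duality *)

Section Duality.
Variables (R : realType) (n : nat) (P1 P2 : block n).

Lemma optimal_opt z : optimal P1 P2 z -> opt R P1 P2 = (joint_cost P1 P2 z)%:E.
Proof.
case=> fz hz; apply/le_anti/andP; split; first by apply: ereal_inf_lbound; exists z.
by apply: le_ereal_inf_tmp => _ [z' fz' <-]; rewrite lee_fin hz.
Qed.

(** Blocks sharing [x] also share [w], so both multiplier terms vanish. *)
Lemma LV_le_joint_cost lam mu z : joint_feasible P1 P2 z ->
  (LV P1 P2 lam mu <= (@joint_cost R n P1 P2 z)%:E)%E.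
Proof.
case: z => -[x y1] [x' y2] [/= f1 f2 e]; subst x'; apply: ereal_inf_lbound.
pose w : {ffun vertex n -> R} := [ffun v : vertex n => \prod_(s < n) sigma (v s) (x s 0)].
exists (x, y1, w); first by split=> // v; rewrite ffunE.
exists (x, y2, w); first by split=> // v; rewrite ffunE.
rewrite /lagrangianV /= subrr big1 => [|v _]; last by rewrite subrr mulr0.
by rewrite addr0 /dotp big1 ?addr0 // => j _; rewrite mxE mulr0.
Qed.

Lemma optimal_multiplier z : optimal P1 P2 z ->
  exists mu : {ffun vertex n -> R},
    ((joint_cost P1 P2 z)%:E <= LV P1 P2 (0 : 'cV[R]_n) mu)%E.
Proof.
move=> [fz hz]; have [f1 f2 e] := fz.
(* With [x] and the other block frozen, joint optimality makes each block optimal in its own [y]. *)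
have [|l1 hl1] := cost_lower_bound f1.
  move=> y fy; have := hz ((z.1.1, y), z.2); rewrite /joint_cost /= lerD2r.
  by apply; split.
have [|l2 hl2] := cost_lower_bound f2.
  move=> y fy; have := hz (z.1, (z.2.1, y)); rewrite /joint_cost /= lerD2l.
  by apply; split.
pose x (v : vertex n) : 'cV[R]_n := \col_j (v j)%:R.
have xE (x' : 'cV[R]_n) : (forall j, x' j 0 = 0 \/ x' j 0 = 1) ->
    x (vertex_of x') = x'.
  move=> hx'; apply/colP => j; rewrite !mxE ffunE.
  by case: (hx' j) => ->; rewrite ?eqxx // eq_sym oner_eq0.
pose S (P : block n) v : set R :=
    [set cost P (x v, y) | y in [set y | feasible P (x v, y)]].
(* The vertices are treated separately. Either cost set may be empty at [v], but [l1] and [l2] give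
   bounds there all the same. *)
have /choice[mu hmu] v : exists m : R, (forall s, S P1 v s -> 0 <= s + m) /\
    (forall t, S P2 v t -> joint_cost P1 P2 z <= t - m).
  apply: (@separating_multiplier _ _ _ (l1 (x v)) (l2 (x v))).
  - by move=> _ [y fy <-]; apply: (hl1 (x v, y)).
  - by move=> _ [y fy <-]; apply: (hl2 (x v, y)).
  - by move=> _ _ [y fy <-] [y' fy' <-]; apply: (hz ((x v, y), (x v, y'))).
exists (finfun mu); apply: le_ereal_inf_tmp => _ [z1 fz1 [z2 fz2 <-]].
rewrite lee_fin /lagrangianV.
under eq_bigr do rewrite mulrBr.
rewrite sumrB (sum_feasibleV _ fz1) (sum_feasibleV _ fz2) !ffunE.
rewrite {1}/dotp [\sum_(j < n) _]big1 => [|j _]; last by rewrite mxE mul0r.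
have S1 : S P1 (vertex_of z1.1.1) (cost P1 z1.1).
  case: z1 fz1 => -[x1 y1] w1 [/= fx1 _]; have [_ _ _ /xE/= e1] := fx1.
  by exists y1; rewrite /= e1.
have S2 : S P2 (vertex_of z2.1.1) (cost P2 z2.1).
  case: z2 fz2 => -[x2 y2] w2 [/= fx2 _]; have [_ _ _ /xE/= e2] := fx2.
  by exists y2; rewrite /= e2.
(* The two points may lie at different vertices: each inequality is used at the vertex of its own
   block, and their sum is the claim. *)
by have := (hmu _).1 _ S1; have := (hmu _).2 _ S2; lra.
Qed.

End Duality.

Theorem theorem5 (R : realType) (n : nat) (P1 P2 : block n)
    (hopt : exists z : ('cV[R]_n * 'cV[R]_(ncol P1)) *
                       ('cV[R]_n * 'cV[R]_(ncol P2)), optimal P1 P2 z) :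
  opt R P1 P2 = dualV R P1 P2.
Proof.
have [z oz] := hopt; rewrite (optimal_opt oz); apply/le_anti/andP; split.
  have [mu hmu] := optimal_multiplier oz; apply: (le_trans hmu).
  by apply: ereal_sup_ubound; exists (0, mu).
apply: ge_ereal_sup => _ [[lam mu] _ <-]; exact: LV_le_joint_cost oz.1.
Qed.
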